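(* Let $K$ be an infinite field and $p=[p_1\exp_{\lambda^{(1)}},\dots,p_m\exp_{\lambda^{(m)}}]^T$ with $p_i\in A=K[t_1,\dots,t_n]$ and $\lambda^{(i)}\in(K\setminus\{0\})^n$. Partition $\{1,\dots,m\}=K_1\,\dot\cup\cdots\dot\cup\,K_l$ into classes of indices with equal exponent vector, $K_i=\{k_{i1}<\dots<k_{il_i}\}$, with common exponent $\mu^i:=\lambda^{(k_{i1})}$. Put $h_i=[p_{k_{i1}},\dots,p_{k_{il_i}}]^T\in A^{l_i}$, $H_i=\chi_{\mu^i}(\ker(\kappa_{h_i}))\subseteq\mathcal S_n^{1\times l_i}$ ($\chi_{\mu^i}$ applied entrywise), and $\phi_i:\mathcal S_n^{1\times l_i}\to\mathcal S_n^{1\times m}$, $[a_1,\dots,a_{l_i}]\mapsto\sum_ja_je_{k_{ij}}$. Then $$\{a\in\mathcal S_n^{1\times m}:\textstyle\sum_{j=1}^ma_j\bullet(p_j\exp_{\lambda^{(j)}})=0\}=\bigoplus_{i=1}^l\phi_i(H_i),$$ and a matrix whose rows generate this module is a kernel representation of the VMPUM of $\{p\}$.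
   Context: $\mathcal S_n=K[t_1,\dots,t_n][\Delta_1;\sigma_1,\delta_1]\cdots[\Delta_n;\sigma_n,\delta_n]$ is the $n$-th difference algebra, $\sigma_i(p)(t)=p(t+e_i)$, $\delta_i=\sigma_i-\mathrm{id}$ (so $\Delta_it_i=t_i\Delta_i+\Delta_i+1$, $\Delta_it_j=t_j\Delta_i$ for $i\neq j$, $\Delta_i$ commuting). It acts on $K^{\mathbb N_0^n}$ by $(\Delta_i\bullet f)(t)=f(t+e_i)-f(t)$ and multiplication by $t_i$; polynomials are identified with polynomial functions. $\exp_\lambda(t)=\lambda_1^{t_1}\cdots\lambda_n^{t_n}$. For $q\in A^k$, $\ker(\kappa_q)=\{a\in\mathcal S_n^{1\times k}:\sum_ia_i\bullet q_i=0\}$. For $\lambda\in(K\setminus\{0\})^n$, $\chi_\lambda$ is the $K$-algebra automorphism of $\mathcal S_n$ with $t_i\mapsto t_i$, $\Delta_i\mapsto\frac1{\lambda_i}(\Delta_i-\lambda_i+1)$. $e_k$ are canonical basis vectors of $\mathcal S_n^{1\times m}$. The VMPUM of a set of signals is the smallest solution set $\{g:R\bullet g=0\}$ ($R$ a matrix over $\mathcal S_n$) containing it. *)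

(* Defs.v *)
(* Concrete model of the n-th difference algebra S_n over a field K.
   An element of S_n is represented by a finite list of terms (c, alpha, beta), standing for
   the normal form  sum c * t^alpha * Delta^beta  (t's on the left, as in the Ore extension
   K[t][Delta_1;..]..[Delta_n;..]).  Two lists denote the same element of S_n iff their
   coefficient functions agree (Sequiv); all predicates below are invariant under Sequiv. *)
From HB Require Import structures.
From mathcomp Require Import all_boot all_order all_algebra.
Set Implicit Arguments. Unset Strict Implicit. Unset Printing Implicit Defensive.
Import Order.TTheory GRing.Theory.
Local Open Scope ring_scope.

Section Defs.
Variables (K : fieldType) (n : nat).

Definition mi := {ffun 'I_n -> nat}.
Definition mi0 : mi := [ffun _ => 0%N].
(* term (c, alpha, beta) = c t^alpha Delta^beta *)
Definition term := (K * mi * mi)%type.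
Definition Sn := seq term.
(* polynomial of A = K[t_1..t_n] as a list of monomial terms (c, alpha) = c t^alpha *)
Definition mpoly := seq (K * mi).
Definition signal := mi -> K.

Definition shift (i : 'I_n) (x : mi) : mi := [ffun j => (x j + (j == i))%N].
Definition diffop (i : 'I_n) (f : signal) : signal := fun x => f (shift i x) - f x.
Definition deltaPow (b : mi) (f : signal) : signal :=
  foldr (fun i g => iter (b i) (diffop i) g) f (enum 'I_n).
Definition mono (a : mi) (x : mi) : K := \prod_(i < n) ((x i)%:R ^+ a i).
Definition act_term (u : term) (f : signal) : signal :=
  fun x => u.1.1 * mono u.1.2 x * deltaPow u.2 f x.
Definition act (s : Sn) (f : signal) : signal := fun x => \sum_(u <- s) act_term u f x.

Definition peval (q : mpoly) : signal := fun x => \sum_(u <- q) u.1 * mono u.2 x.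
Definition expo (lam : 'I_n -> K) : signal := fun x => \prod_(i < n) lam i ^+ x i.

Definition coef (s : Sn) (a b : mi) : K :=
  \sum_(u <- s | (u.1.2 == a) && (u.2 == b)) u.1.1.
Definition Sequiv (s s' : Sn) : Prop := forall a b, coef s a b = coef s' a b.

(* combine per-variable normal forms (coef, exponent of t_i, exponent of Delta_i) *)
Definition comb_step (i : 'I_n) (x : K * nat * nat) (y : K * mi * mi) : K * mi * mi :=
  (x.1.1 * y.1.1, [ffun k => if k == i then x.1.2 else y.1.2 k],
                  [ffun k => if k == i then x.2 else y.2 k]).
Definition combine (L : 'I_n -> seq (K * nat * nat)) : seq (K * mi * mi) :=
  foldr (fun (i : 'I_n) (acc : seq (K * mi * mi)) =>
     [seq comb_step i x y | x <- L i, y <- acc])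
   [:: (1, mi0, mi0)] (enum 'I_n).

(* normal form of Delta^b t^c (one variable):
   Delta^b = sum_k C(b,k)(-1)^(b-k) sigma^k, sigma^k t^c = (t+k)^c sigma^k,
   sigma^k = sum_j C(k,j) Delta^j *)
Definition dt (b c : nat) : seq (K * nat * nat) :=
  [seq (\sum_(k < b.+1) ((-1 : K) ^+ (b - k) * 'C(b, k)%:R * 'C(c, r)%:R
             * (nat_of_ord k)%:R ^+ (c - r) * 'C(nat_of_ord k, j)%:R), r, j)
   | r <- iota 0 c.+1, j <- iota 0 b.+1].

(* (c t^a Delta^b) * (d t^g Delta^e) = c d t^a (Delta^b t^g) Delta^e *)
Definition mul_term (u v : term) : Sn :=
  [seq (u.1.1 * v.1.1 * w.1.1, [ffun i => (u.1.2 i + w.1.2 i)%N], [ffun i => (w.2 i + v.2 i)%N])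
   | w : K * mi * mi <- combine (fun i => dt (u.2 i) (v.1.2 i))].
Definition mulS (s s' : Sn) : Sn := flatten [seq mul_term u v | u <- s, v <- s'].

(* chi_lam : t_i |-> t_i, Delta_i |-> (1/lam_i)(Delta_i - lam_i + 1) *)
Definition chi_term (lam : 'I_n -> K) (u : term) : Sn :=
  [seq (u.1.1 * w.1.1, u.1.2, w.2)
   | w : K * mi * mi <- combine (fun i => [seq ((lam i)^-1 ^+ (u.2 i) * 'C(u.2 i, j)%:R
                                    * (1 - lam i) ^+ (u.2 i - j), 0%N, j)
                            | j <- iota 0 (u.2 i).+1])].
Definition chiS (lam : 'I_n -> K) (s : Sn) : Sn := flatten (map (chi_term lam) s).

Definition rowEq (m : nat) (a a' : 'I_m -> Sn) : Prop := forall k, Sequiv (a k) (a' k).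
Definition zrow (m : nat) : 'I_m -> Sn := fun _ => [::].
Definition kerS (m : nat) (g : 'I_m -> signal) (a : 'I_m -> Sn) : Prop :=
  forall x, \sum_(j < m) act (a j) (g j) x = 0.
Definition kerSeq (h : seq signal) (c : seq Sn) : Prop :=
  size c = size h /\
  forall x, \sum_(j < size h) act (nth [::] c j) (nth (fun _ => 0) h j) x = 0.
Definition lincomb (q m : nat) (c : 'I_q -> Sn) (R : 'I_q -> 'I_m -> Sn) : 'I_m -> Sn :=
  fun j => flatten [seq mulS (c r) (R r j) | r <- enum 'I_q].
Definition sol (q m : nat) (R : 'I_q -> 'I_m -> Sn) (g : 'I_m -> signal) : Prop :=
  forall r, kerS g (R r).

Definition Kcls (m l : nat) (cls : 'I_m -> 'I_l) (i : 'I_l) : seq 'I_m :=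
  [seq k <- enum 'I_m | cls k == i].
Definition phi (m : nat) (Ki : seq 'I_m) (c : seq Sn) : 'I_m -> Sn :=
  fun k => flatten [seq x.2 | x <- zip Ki c & x.1 == k].
Definition inH (mu : 'I_n -> K) (h : seq signal) (b : seq Sn) : Prop :=
  exists c, kerSeq h c /\ size b = size c /\
    forall j, (j < size c)%N -> Sequiv (chiS mu (nth [::] c j)) (nth [::] b j).
Definition dsum (m l : nat) (cls : 'I_m -> 'I_l) (b : 'I_l -> seq Sn) : 'I_m -> Sn :=
  fun k => flatten [seq phi (Kcls cls i) (b i) k | i <- enum 'I_l].
Definition psig (m : nat) (p : 'I_m -> mpoly) (lam : 'I_m -> 'I_n -> K) : 'I_m -> signal :=
  fun j x => peval (p j) x * expo (lam j) x.
Definition muc (m l : nat) (lam : 'I_m -> 'I_n -> K) (cls : 'I_m -> 'I_l) (i : 'I_l) : 'I_n -> K :=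
  head (fun _ => 1) [seq lam k | k <- Kcls cls i].
Definition hc (m l : nat) (p : 'I_m -> mpoly) (cls : 'I_m -> 'I_l) (i : 'I_l) : seq signal :=
  [seq peval (p k) | k <- Kcls cls i].

End Defs.

(* Main.v *)
(* Multiplication by exp_mu conjugates the action of a into that of chi_mu(a), and chi_mu is
   invertible with inverse chi_{1/mu}.  Hence sum_j a_j . (p_j exp_{lambda^(j)}) equals
   sum_i F_i exp_{mu^i}, where F_i is the image of h_i under chi_{mu^i}^{-1} of the i-th block of a,
   and the F_i are polynomial functions.  Exponentials with distinct exponent vectors are
   independent over such functions: Delta_j acts nilpotently on polynomial functions, so if
   mu_j <> c then sigma_j - c is injective on {F exp_mu}, while powers of it kill F exp_mu when
   mu_j = c.  This uses only nilpotency, never degrees, and so it works in every characteristic,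
   although polynomials do not act faithfully as functions in positive characteristic. *)
Require Import Defs.
From HB Require Import structures.
From mathcomp Require Import all_boot all_order all_algebra.
From mathcomp Require Import ring.
From Stdlib Require Import FunctionalExtensionality.
Set Implicit Arguments. Unset Strict Implicit. Unset Printing Implicit Defensive.
Import Order.TTheory GRing.Theory.
Local Open Scope ring_scope.

(** * Linear operators on signals and the binomial formula for their powers *)

Section DifferenceOperators.
Variables (K : fieldType) (n : nat).
Implicit Types (f g h : signal K n) (x : mi n) (i j : 'I_n) (lam : 'I_n -> K).

Definition linear_op (D : signal K n -> signal K n) : Prop :=
  forall c f g, D (fun x => c * f x + g x) = fun x => c * D f x + D g x.

Lemma linear_op_iter D k : linear_op D -> linear_op (iter k D).
Proof.
move=> linD; elim: k => [//|k IHk] c f g; rewrite iterS (IHk c f g) (linD c).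
by [].
Qed.

Lemma linear_op0 D : linear_op D -> D (fun=> 0) = fun=> 0.
Proof.
move=> linD; have E := linD (-1) (fun=> 0) (fun=> 0); apply: functional_extensionality => x.
have Z : (fun x : mi n => -1 * 0 + 0 : K) = fun=> 0.
  by apply: functional_extensionality => y; rewrite mulr0 addr0.
have {E} := congr1 (fun h => h x) (etrans (congr1 D (esym Z)) E).
by rewrite mulN1r addNr.
Qed.

Lemma linear_opD D f g : linear_op D -> D (fun x => f x + g x) = fun x => D f x + D g x.
Proof.
move=> linD.
have Z : (fun x => f x + g x) = fun x => 1 * f x + g x.
  by apply: functional_extensionality => x; rewrite mul1r.
rewrite Z linD; apply: functional_extensionality => x; by rewrite mul1r.
Qed.

Lemma linear_opZ D c f : linear_op D -> D (fun x => c * f x) = fun x => c * D f x.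
Proof.
move=> linD.
have Z : (fun x => c * f x) = fun x => c * f x + (fun=> 0) x.
  by apply: functional_extensionality => x; rewrite addr0.
rewrite Z linD linear_op0 //; apply: functional_extensionality => x.
by rewrite addr0.
Qed.

Lemma linear_op_sum D (T : Type) (s : seq T) (F : T -> signal K n) : linear_op D ->
  D (fun x => \sum_(u <- s) F u x) = fun x => \sum_(u <- s) D (F u) x.
Proof.
move=> linD; elim: s => [|u s IHs].
  have -> : (fun x => \sum_(u <- [::]) F u x) = fun=> 0.
    by apply: functional_extensionality => x; rewrite big_nil.
  by rewrite linear_op0 //; apply: functional_extensionality => x; rewrite big_nil.
have -> : (fun x => \sum_(v <- u :: s) F v x) = fun x => F u x + \sum_(v <- s) F v x.
  by apply: functional_extensionality => x; rewrite big_cons.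
by rewrite linear_opD // IHs; apply: functional_extensionality => x; rewrite big_cons.
Qed.

(** Pascal's rule, as the induction step of the binomial theorem. The sequence [a] stands for the
    values of [iter k D g] at a point. *)
Lemma pascal_sum (c : K) b (a : nat -> K) :
  \sum_(k < b.+1) 'C(b, k)%:R * c ^+ (b - k) * (a k.+1 + c * a k) =
  \sum_(k < b.+2) 'C(b.+1, k)%:R * c ^+ (b.+1 - k) * a k.
Proof.
have -> : \sum_(k < b.+1) 'C(b, k)%:R * c ^+ (b - k) * (a k.+1 + c * a k) =
  \sum_(k < b.+1) 'C(b, k)%:R * c ^+ (b - k) * a k.+1 +
  \sum_(k < b.+2) 'C(b, k)%:R * c ^+ (b.+1 - k) * a k.
  rewrite [X in _ + X]big_ord_recr /= bin_small // !mul0r addr0 -big_split /=.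
  apply: eq_bigr => k _; rewrite (subSn (leq_ord k)) exprS.
  rewrite mulrDr; congr (_ + _).
  by rewrite mulrCA [X in _ = X * _]mulrCA !mulrA.
rewrite [X in _ + X]big_ord_recl [RHS]big_ord_recl /= !bin0 addrCA; congr (_ + _).
rewrite -big_split; apply: eq_bigr => k _ /=.
by rewrite /bump /= add1n subSS binS natrD !mulrDl addrC.
Qed.

(** Binomial theorem for D + c, valid because a linear D commutes with scalars. The terms with b < k
    < N vanish; a common bound [N] for several powers [b] is what later allows double sums to be
    exchanged. *)
Lemma iter_binomial D c b N g x : linear_op D -> (b < N)%N ->
  iter b (fun h x => D h x + c * h x) g x =
  \sum_(k < N) 'C(b, k)%:R * c ^+ (b - k) * iter k D g x.
Proof.
move=> linD ltbN; transitivity (\sum_(k < b.+1) 'C(b, k)%:R * c ^+ (b - k) * iter k D g x).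
  elim: b g {ltbN} => [|b IHb] g.
    by rewrite big_ord1 bin0 subnn expr0 mulr1 mul1r.
  rewrite iterSr IHb -(pascal_sum c b (fun k => iter k D g x)).
  apply: eq_bigr => k _; congr (_ * _).
  rewrite (linear_opD _ _ (linear_op_iter k linD)).
  by rewrite (linear_opZ _ _ (linear_op_iter k linD)) iterSr.
rewrite (big_ord_widen _ (fun k => 'C(b, k)%:R * c ^+ (b - k) * iter k D g x) ltbN).
rewrite big_mkcond; apply: eq_bigr => k _; case: ltnP => // ltbk.
by rewrite bin_small // !mul0r.
Qed.

(** * Commuting difference operators and monomial functions *)

Lemma diffop_at i f x : diffop i f x = f (shift i x) - f x.
Proof. by []. Qed.

Lemma diffop_linear i : linear_op (@diffop K n i).
Proof. by move=> c f g; apply: functional_extensionality => x; rewrite /diffop; ring. Qed.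

Lemma shiftC i j x : shift i (shift j x) = shift j (shift i x).
Proof. by apply/ffunP => k; rewrite !ffunE addnAC. Qed.

Lemma diffopC i j f : diffop i (diffop j f) = diffop j (diffop i f).
Proof.
by apply: functional_extensionality => x; rewrite /diffop (shiftC i j); ring.
Qed.

Lemma iter_diffopC i j k k' f :
  iter k (diffop i) (iter k' (diffop j) f) = iter k' (diffop j) (iter k (diffop i) f).
Proof.
elim: k => //= k ->; elim: k' => //= k' IH; by rewrite diffopC IH.
Qed.

(** [deltaPow] along an arbitrary list of variables, so that induction on the list is possible. *)
Definition delta_on (s : seq 'I_n) (b : mi n) f : signal K n :=
  foldr (fun i g => iter (b i) (diffop i) g) f s.

Lemma iter_delta_on i k s b f :
  iter k (diffop i) (delta_on s b f) = delta_on s b (iter k (diffop i) f).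
Proof. by elim: s => //= j s <-; rewrite iter_diffopC. Qed.

Lemma deltaPowD (b b' : mi n) f :
  deltaPow [ffun i => (b i + b' i)%N] f = deltaPow b (deltaPow b' f).
Proof.
rewrite /deltaPow -!/(delta_on _ _ _); elim: (enum _) => //= i s ->.
by rewrite ffunE iterD; congr (iter _ _ _); rewrite iter_delta_on.
Qed.

Definition mi1 i k : mi n := [ffun j => if j == i then k else 0%N].

Lemma deltaPow1 i k f : deltaPow (mi1 i k) f = iter k (diffop i) f.
Proof.
rewrite /deltaPow -/(delta_on _ _ _).
have E s : uniq s -> delta_on s (mi1 i k) f = if i \in s then iter k (diffop i) f else f.
  elim: s => //= j s IHs /andP[njs us]; rewrite IHs // ffunE inE eq_sym.
  by case: eqP => [->|] //=; rewrite (negbTE njs).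
by rewrite E ?enum_uniq // mem_enum.
Qed.

Lemma delta_linear b : linear_op (@deltaPow K n b).
Proof.
rewrite /deltaPow => c f g; elim: (enum _) => //= i s ->.
exact: (linear_op_iter _ (@diffop_linear i)).
Qed.

Lemma iter_diffopM i k h f : (forall x, h (shift i x) = h x) ->
  iter k (diffop i) (fun x => h x * f x) = fun x => h x * iter k (diffop i) f x.
Proof.
move=> hi; elim: k => //= k ->; apply: functional_extensionality => x.
by rewrite /diffop hi mulrBr.
Qed.

Lemma mono0 x : mono K (mi0 n) x = 1.
Proof. by rewrite /mono big1 // => i _; rewrite ffunE expr0. Qed.

Lemma monoD (a a' : mi n) x : mono K [ffun i => (a i + a' i)%N] x = mono K a x * mono K a' x.
Proof. by rewrite /mono -big_split; apply: eq_bigr => i _; rewrite ffunE exprD. Qed.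

Lemma mono1 i k x : mono K (mi1 i k) x = (x i)%:R ^+ k.
Proof.
rewrite /mono (bigD1 i) //= ffunE eqxx big1 ?mulr1 // => j /negbTE nji.
by rewrite ffunE nji expr0.
Qed.

Lemma mono_shift (a : mi n) i x : a i = 0%N -> mono K a (shift i x) = mono K a x.
Proof.
move=> ai; apply: eq_bigr => j _; rewrite ffunE.
by case: eqP => [->|]; rewrite ?ai ?expr0 // addn0.
Qed.

(** * Normal forms assembled variable by variable, and their action *)

Definition combine_on (s : seq 'I_n) (L : 'I_n -> seq (K * nat * nat)) :=
  foldr (fun (i : 'I_n) (acc : seq (K * mi n * mi n)) =>
     [seq comb_step i v y | v <- L i, y <- acc]) [:: (1, mi0 n, mi0 n)] s.

(** Variables not yet treated have exponent zero, so the new variable of an induction step commutes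
    with everything already assembled. *)
Lemma mem_combine_on s L w k : w \in combine_on s L ->
  if k \in s then (w.1.2 k, w.2 k) \in [seq (v.1.2, v.2) | v <- L k]
  else (w.1.2 k, w.2 k) == (0%N, 0%N).
Proof.
elim: s w => [|i s IHs] w /=; first by rewrite inE => /eqP -> /=; rewrite !ffunE.
case/allpairsP=> -[v y] /= [vL /IHs ys ->]; rewrite /= !ffunE inE.
by case: eqP => [->|] //=; rewrite (map_f _ vL).
Qed.

Definition op1 i (L : seq (K * nat * nat)) f : signal K n :=
  fun x => \sum_(v <- L) v.1.1 * (x i)%:R ^+ v.1.2 * iter v.2 (diffop i) f x.

(* The entries of [combine] carry the t's to the left of all Delta's; composing the one-variable
   operators gives the same result because t_i and Delta_j commute for i <> j. *)
Lemma act_combine_on s L f : uniq s ->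
  act (combine_on s L) f = foldr (fun i g => op1 i (L i) g) f s.
Proof.
elim: s => [_|i s IHs /= /andP[nis us]].
  apply: functional_extensionality => x; rewrite /act big_seq1 /act_term /= mono0 !mul1r.
  by rewrite /deltaPow; elim: (enum _) => //= j s <-; rewrite ffunE.
rewrite -IHs //; apply: functional_extensionality => x.
rewrite {1}/act (big_allpairs_dep) /op1; apply: eq_bigr => v _ /=.
have -> : iter v.2 (diffop i) (act (combine_on s L) f) =
    fun x => \sum_(y <- combine_on s L) iter v.2 (diffop i) (act_term y f) x.
  exact: (linear_op_sum _ _ (linear_op_iter _ (@diffop_linear i))).
rewrite mulr_sumr; apply: eq_big_seq => y /(mem_combine_on i).
rewrite (negbTE nis) => /eqP[ya yb].
have -> : act_term y f = fun x => y.1.1 * mono K y.1.2 x * deltaPow y.2 f x by [].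
rewrite (@iter_diffopM i _ (fun x => y.1.1 * mono K y.1.2 x)); last first.
  by move=> z; rewrite mono_shift.
rewrite -deltaPow1 -deltaPowD /act_term /=.
have -> : [ffun k => if k == i then v.1.2 else y.1.2 k] =
    [ffun k => (mi1 i v.1.2 k + y.1.2 k)%N].
  by apply/ffunP => k; rewrite !ffunE; case: eqP => [->|//]; rewrite ya addn0.
rewrite monoD mono1.
have -> : [ffun k => if k == i then v.2 else y.2 k] = [ffun k => (mi1 i v.2 k + y.2 k)%N].
  by apply/ffunP => k; rewrite !ffunE; case: eqP => [->|//]; rewrite yb addn0.
by ring.
Qed.

(** * The commutation rule for powers of Delta and t *)

Definition sigma i f : signal K n := fun x => f (shift i x).

Lemma sigma_linear i : linear_op (sigma i).
Proof. by []. Qed.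

Lemma diffopE i : @diffop K n i = fun h x => sigma i h x + -1 * h x.
Proof.
by apply: functional_extensionality => f; apply: functional_extensionality => x;
   rewrite mulN1r.
Qed.

Lemma sigmaE i : sigma i = fun h x => diffop i h x + 1 * h x.
Proof.
apply: functional_extensionality => f; apply: functional_extensionality => x.
by rewrite mul1r /diffop subrK.
Qed.

Lemma iter_sigma i k f x : iter k (sigma i) f x = f (iter k (shift i) x).
Proof. by elim: k x => //= k IHk x; rewrite /sigma IHk -iterSr. Qed.

Lemma iter_shift i k x : iter k (shift i) x i = (x i + k)%N.
Proof. by elim: k => //= [|k IHk]; rewrite ?addn0 // ffunE IHk eqxx addnS addn1. Qed.

(** Three binomial expansions: Delta^b in powers of sigma = Delta + 1, then (t+k)^c produced by
    moving sigma^k past t^c, then sigma^k back in powers of Delta. Collecting t^r Delta^j gives the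
    coefficients of [dt]. *)
Lemma op1_dt i b c f :
  op1 i (dt K b c) f = iter b (diffop i) (fun x => (x i)%:R ^+ c * f x).
Proof.
apply: functional_extensionality => x.
rewrite diffopE (iter_binomial _ _ _ (sigma_linear i) (ltnSn b)).
have E k : (k < b.+1)%N ->
    iter k (sigma i) (fun x => (x i)%:R ^+ c * f x) x =
    (\sum_(r < c.+1) 'C(c, r)%:R * k%:R ^+ (c - r) * (x i)%:R ^+ r) *
    (\sum_(j < b.+1) 'C(k, j)%:R * iter j (diffop i) f x).
  move=> ltkb; rewrite iter_sigma iter_shift; congr (_ * _).
    rewrite natrD addrC exprDn; apply: eq_bigr => r _.
    by rewrite -[LHS]mulr_natl mulrA.
  rewrite -iter_sigma sigmaE (iter_binomial _ _ _ (@diffop_linear i) ltkb).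
  by apply: eq_bigr => j _; rewrite expr1n mulr1.
rewrite /op1 /dt big_allpairs_dep -[iota 0 c.+1]/(index_iota 0 c.+1).
rewrite -[iota 0 b.+1]/(index_iota 0 b.+1) big_mkord.
under eq_bigr => r _ do rewrite big_mkord.
under [RHS]eq_bigr => k _ do rewrite E // big_distrlr /= mulr_sumr.
rewrite [RHS]exchange_big; apply: eq_bigr => r _ /=.
under [RHS]eq_bigr => k _ do rewrite mulr_sumr.
rewrite [RHS]exchange_big; apply: eq_bigr => j _ /=.
by rewrite !mulr_suml; apply: eq_bigr => k _; ring.
Qed.

Lemma deltaPow_mono (b c : mi n) f :
  deltaPow b (fun x => mono K c x * f x) =
  foldr (fun i g => op1 i (dt K (b i) (c i)) g) f (enum 'I_n).
Proof.
rewrite /deltaPow -/(delta_on _ _ _).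
have -> : mono K c = fun x => \prod_(i <- enum 'I_n) (x i)%:R ^+ c i.
  by apply: functional_extensionality => x; rewrite /mono big_enum.
have := enum_uniq 'I_n; elim: (enum _) => [_|i s IHs /= /andP[nis us]] /=.
  by apply: functional_extensionality => x; rewrite big_nil mul1r.
rewrite -IHs // op1_dt; congr (iter _ _ _).
pose g x := (\prod_(j <- s) (x j)%:R ^+ c j) * f x.
have -> : (fun x : mi n => (\prod_(j <- i :: s) (x j)%:R ^+ c j) * f x) =
    fun x => (x i)%:R ^+ c i * g x.
  by apply: functional_extensionality => x; rewrite big_cons -mulrA.
(* It remains to move the power of t_i past Delta_j for each j in [s]; all these j differ from i. *)
rewrite -/g; move: g => g {IHs us}; elim: s nis => //= j s IHs.
rewrite inE negb_or => /andP[nij nis]; rewrite IHs //.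
rewrite (@iter_diffopM j _ (fun x => (x i)%:R ^+ c i)) // => x.
by rewrite ffunE (negbTE nij) addn0.
Qed.

(** * The action respects multiplication and equality in the difference algebra *)

Lemma act_term_linear u : linear_op (@act_term K n u).
Proof.
move=> c f g; apply: functional_extensionality => x.
by rewrite /act_term (@delta_linear u.2 c f g); ring.
Qed.

Lemma act_linear (s : Sn K n) : linear_op (act s).
Proof.
move=> c f g; apply: functional_extensionality => x.
rewrite /act mulr_sumr -big_split; apply: eq_bigr => u _.
by rewrite act_term_linear.
Qed.

Lemma act_mul_term u v f : act (mul_term u v) f = act_term u (act_term v f).
Proof.
apply: functional_extensionality => x.
have -> : act_term u (act_term v f) x = v.1.1 * (u.1.1 * mono K u.1.2 x *
   deltaPow u.2 (fun x => mono K v.1.2 x * deltaPow v.2 f x) x).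
  have -> : act_term v f = fun x => v.1.1 * (mono K v.1.2 x * deltaPow v.2 f x).
    by apply: functional_extensionality => y; rewrite mulrA.
  by rewrite (linear_opZ _ _ (act_term_linear u)).
rewrite deltaPow_mono -(act_combine_on _ _ (enum_uniq _)).
rewrite /act /mul_term big_map !mulr_sumr; apply: eq_bigr => w _.
by rewrite /act_term /= deltaPowD monoD; ring.
Qed.

Lemma act_flatten ss f x : act (flatten ss) f x = \sum_(s <- ss) act s f x :> K.
Proof. by rewrite /act big_flatten. Qed.

Lemma act_mulS (s s' : Sn K n) f : act (mulS s s') f = act s (act s' f).
Proof.
apply: functional_extensionality => x; rewrite act_flatten big_allpairs_dep.
apply: eq_bigr => u _; rewrite (linear_op_sum _ _ (act_term_linear u)).
by apply: eq_bigr => v _; rewrite act_mul_term.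
Qed.

(** Terms are grouped by their pair of exponents. Hence any expression linear in the terms depends
    on [coef] alone. *)
Lemma sum_coef (s : Sn K n) (T : seq (mi n * mi n)) (G : mi n -> mi n -> K) :
  uniq T -> {subset [seq (u.1.2, u.2) | u <- s] <= T} ->
  \sum_(u <- s) u.1.1 * G u.1.2 u.2 = \sum_(k <- T) coef s k.1 k.2 * G k.1 k.2.
Proof.
move=> uT sT; under [RHS]eq_bigr => k _ do rewrite /coef mulr_suml big_mkcond.
rewrite exchange_big; apply: eq_big_seq => u us /=.
rewrite (bigD1_seq (u.1.2, u.2)) //=; last by apply: sT; apply/mapP; exists u.
rewrite !eqxx /= big1 ?addr0 // => -[a b] /negbTE nk /=.
by case: ifP => // /andP[/eqP ua /eqP ub]; rewrite -ua -ub eqxx in nk.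
Qed.

Lemma act_Sequiv (s s' : Sn K n) f : Sequiv s s' -> act s f = act s' f.
Proof.
move=> ss'; apply: functional_extensionality => x.
(* One list of exponent pairs serves both representatives, so the two sums can be compared
   termwise. *)
pose key (u : term K n) := (u.1.2, u.2); pose T := undup (map key (s ++ s')).
have E r : \sum_(u <- r) act_term u f x =
    \sum_(u <- r) u.1.1 * (mono K u.1.2 x * deltaPow u.2 f x).
  by apply: eq_bigr => u _; rewrite mulrA.
have uT : uniq T by exact: undup_uniq.
rewrite /act !E !(@sum_coef _ T (fun a b => mono K a x * deltaPow b f x)) => [||k|//|k].
- by apply: eq_bigr => k _; rewrite ss'.
- exact: uT.
- by rewrite mem_undup map_cat mem_cat => ->; rewrite orbT.
- by rewrite mem_undup map_cat mem_cat => ->.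
Qed.

(** * The automorphism chi: conjugation by exponentials, and its inverse *)

(** Expansion of ((Delta - c + 1)/c)^b, the one-variable list inside [chi_term]. *)
Definition chi1 (c : K) (b : nat) : seq (K * nat * nat) :=
  [seq (c^-1 ^+ b * 'C(b, k)%:R * (1 - c) ^+ (b - k), 0%N, k) | k <- iota 0 b.+1].

Lemma expo_shift lam i x : expo lam (shift i x) = lam i * expo lam x.
Proof.
rewrite /expo (bigD1 i) //= [in RHS](bigD1 i) //= ffunE eqxx addn1 exprS -mulrA.
congr (_ * (_ * _)); apply: eq_bigr => j /negbTE nji.
by rewrite ffunE nji addn0.
Qed.

Lemma expo_neq0 lam x : (forall i, lam i != 0) -> expo lam x != 0.
Proof.
move=> lam0; rewrite /expo prodf_seq_neq0; apply/allP => i _.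
by apply/implyP => _; exact: expf_neq0.
Qed.

(** Since exp_lam(t + e_i) = lam_i exp_lam(t), the operator Delta_i + 1 - lam_i sends f exp_lam to
    lam_i (Delta_i f) exp_lam. Iterating b times yields lam_i^b, which the factor of [chi1]
    cancels. *)
Lemma op1_chi1 lam i b f : lam i != 0 ->
  op1 i (chi1 (lam i) b) (fun x => f x * expo lam x) =
  fun x => iter b (diffop i) f x * expo lam x.
Proof.
move=> lam0; apply: functional_extensionality => x.
transitivity ((lam i)^-1 ^+ b *
  iter b (fun h x => diffop i h x + (1 - lam i) * h x) (fun x => f x * expo lam x) x).
  rewrite (iter_binomial _ _ _ (@diffop_linear i) (ltnSn b)) /op1 big_map.
  rewrite -[iota 0 b.+1]/(index_iota 0 b.+1) big_mkord mulr_sumr.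
  by apply: eq_bigr => j _ /=; ring.
suff -> : iter b (fun h x => diffop i h x + (1 - lam i) * h x)
    (fun x => f x * expo lam x) x = lam i ^+ b * (iter b (diffop i) f x * expo lam x).
  by rewrite !mulrA -exprMn mulVf // expr1n mul1r.
elim: b x => [|b IHb] x; first by rewrite mul1r.
rewrite iterS diffop_at !IHb expo_shift iterS diffop_at exprS.
move: (iter b _ _ x) (iter b _ _ _) => A B; ring.
Qed.

Lemma act_chiS lam (s : Sn K n) f x : (forall i, lam i != 0) ->
  act (chiS lam s) (fun x => f x * expo lam x) x = act s f x * expo lam x.
Proof.
move=> lam0; rewrite act_flatten big_map mulr_suml; apply: eq_bigr => u _.
have E : foldr (fun i g => op1 i (chi1 (lam i) (u.2 i)) g)
    (fun x => f x * expo lam x) (enum 'I_n) = fun x => deltaPow u.2 f x * expo lam x.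
  rewrite /deltaPow; elim: (enum _) => //= i r ->; exact: op1_chi1.
rewrite /act_term -mulrA -[X in _ = _ * X](congr1 (fun g => g x) E).
rewrite -(act_combine_on _ _ (enum_uniq _)) /act big_map mulr_sumr.
apply: eq_big_seq => w ws; rewrite /act_term /=.
(* Every entry of [chi1] has t-exponent zero, so the only t's are those of [u]. *)
have -> : w.1.2 = mi0 n.
  apply/ffunP => k; have := mem_combine_on k ws; have kin : k \in enum 'I_n by rewrite mem_enum.
  rewrite kin ffunE.
  by case/mapP=> v /mapP[j _ ->] [].
by rewrite mono0; ring.
Qed.

(** Distributivity: a weight that is a product over the variables turns the sum over assembled terms
    into a product of one-variable sums. This reduces invertibility of chi to one variable. *)
Lemma sum_combine (L : 'I_n -> seq (K * nat * nat)) (G : 'I_n -> nat -> K) :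
  \sum_(w <- combine L) w.1.1 * \prod_i G i (w.2 i) =
  \prod_i \sum_(v <- L i) v.1.1 * G i v.2.
Proof.
rewrite -[combine L]/(combine_on (enum 'I_n) L) -[RHS]big_enum /=.
under eq_bigr => w _ do rewrite -big_enum /=.
have := enum_uniq 'I_n; elim: (enum _) => [_|i s IHs /= /andP[nis us]].
  by rewrite big_seq1 !big_nil mulr1.
rewrite big_allpairs_dep big_cons -IHs // big_distrlr /=; apply: eq_bigr => v _.
apply: eq_bigr => y _; rewrite big_cons /= ffunE eqxx.
have -> : \prod_(j <- s) G j ([ffun k => if k == i then v.2 else y.2 k] j) =
    \prod_(j <- s) G j (y.2 j).
  apply: eq_big_seq => j js; rewrite ffunE.
  by case: eqP => // ji; rewrite -ji js in nis.
by ring.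
Qed.

Lemma sum_chiS lam (s : Sn K n) a (G : 'I_n -> nat -> K) :
  \sum_(u <- chiS lam s | u.1.2 == a) u.1.1 * \prod_i G i (u.2 i) =
  \sum_(u <- s | u.1.2 == a) u.1.1 *
     \prod_i \sum_(v <- chi1 (lam i) (u.2 i)) v.1.1 * G i v.2.
Proof.
rewrite big_flatten big_map [RHS]big_mkcond; apply: eq_bigr => u _ /=.
rewrite -sum_combine big_map /=; case: eqP => _; last by rewrite big1.
by rewrite mulr_sumr; apply: eq_bigr => w _; rewrite mulrA.
Qed.

(** Writes the test for exponent [b] as a product of Kronecker deltas, the shape to which [sum_chiS]
    applies. *)
Lemma coef_prod (s : Sn K n) a b :
  coef s a b = \sum_(u <- s | u.1.2 == a) u.1.1 * \prod_i (u.2 i == b i)%:R.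
Proof.
rewrite /coef big_mkcondr; apply: eq_bigr => u _; case: eqP => [->|nub].
  by rewrite big1 ?mulr1 // => i _; rewrite eqxx.
case: (pickP (fun i => u.2 i != b i)) => [i /negbTE ni|all].
  by rewrite (bigD1 i) //= ni mul0r mulr0.
by case: nub; apply/ffunP => i; apply/eqP; move/negbFE: (all i).
Qed.

(** The image of Delta under chi_c, with 'X in the role of Delta. *)
Definition chi_poly (c : K) : {poly K} := c^-1 *: ('X + (1 - c)%:P).

Lemma chi1_horner (c : K) b (P : {poly K}) :
  \sum_(v <- chi1 c b) v.1.1 *: P ^+ v.2 = (chi_poly c \Po P) ^+ b.
Proof.
rewrite /chi_poly comp_polyZ comp_polyD comp_polyX comp_polyC exprZn addrC exprDn.
rewrite big_map -[iota 0 b.+1]/(index_iota 0 b.+1) big_mkord scaler_sumr.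
apply: eq_bigr => j _ /=; rewrite -mulrA -!scalerA; congr (_ *: _).
by rewrite -polyC_exp mul_polyC scaler_nat.
Qed.

(** The double sum is the coefficient of 'X^j in the b-th power of a composite of two affine
    polynomials, and these are inverse to each other. *)
Lemma chi1_inv (c : K) (b j : nat) : c != 0 ->
  \sum_(v <- chi1 c^-1 b) v.1.1 * (\sum_(w <- chi1 c v.2) w.1.1 * (w.2 == j)%:R) =
  (b == j)%:R.
Proof.
move=> c0.
have E b' : \sum_(w <- chi1 c b') w.1.1 * (w.2 == j)%:R = (chi_poly c ^+ b')`_j.
  have := chi1_horner c b' 'X; rewrite comp_polyXr => <-.
  by rewrite coef_sum; apply: eq_bigr => w _; rewrite coefZ coefXn eq_sym.
under eq_bigr => v _ do rewrite E -coefZ.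
rewrite -coef_sum chi1_horner.
have -> : chi_poly c^-1 \Po chi_poly c = 'X.
  rewrite /chi_poly comp_polyZ comp_polyD comp_polyX comp_polyC invrK scalerDr scalerA.
  rewrite mulfV // scale1r scale_polyC -addrA -polyCD mulrBr mulr1 mulfV //.
  by rewrite addrC addrA subrK subrr ?add0r ?polyC0 ?addr0.
by rewrite coefXn eq_sym.
Qed.

(** Proved on coefficients rather than through the action, since the action need not be faithful. *)
Lemma chiS_inv lam (s : Sn K n) : (forall i, lam i != 0) ->
  Sequiv (chiS lam (chiS (fun i => (lam i)^-1) s)) s.
Proof.
move=> lam0 a b; rewrite !coef_prod.
rewrite (@sum_chiS _ _ _ (fun i k => (k == b i)%:R)).
rewrite (@sum_chiS _ _ _ (fun i k => \sum_(v <- chi1 (lam i) k) v.1.1 * (v.2 == b i)%:R)).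
by apply: eq_bigr => u _; congr (_ * _); apply: eq_bigr => i _; exact: chi1_inv.
Qed.

(** * Signals on which a difference operator is nilpotent *)

Definition nilpotent i f : Prop := exists N, iter N (diffop i) f = fun=> 0.

Lemma iter_diffop_0 i k f N : iter N (diffop i) f = (fun=> 0) ->
  (N <= k)%N -> iter k (diffop i) f = fun=> 0.
Proof.
move=> fN /subnK <-; rewrite iterD fN.
exact: linear_op0 (linear_op_iter _ (@diffop_linear i)).
Qed.

Lemma nilpotent_linear i c f g :
  nilpotent i f -> nilpotent i g -> nilpotent i (fun x => c * f x + g x).
Proof.
move=> [N fN] [M gM]; exists (maxn N M).
rewrite (linear_op_iter _ (@diffop_linear i)).
rewrite (iter_diffop_0 fN) ?leq_maxl // (iter_diffop_0 gM) ?leq_maxr //.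
by apply: functional_extensionality => x; rewrite mulr0 addr0.
Qed.

Lemma nilpotent_ext i f g : (forall x, f x = g x) -> nilpotent i f -> nilpotent i g.
Proof. by move=> /functional_extensionality ->. Qed.

Lemma nilpotent0 i : nilpotent i (fun=> 0).
Proof. by exists 0%N. Qed.

Lemma nilpotentZ i c f : nilpotent i f -> nilpotent i (fun x => c * f x).
Proof.
move=> nf; apply: nilpotent_ext (nilpotent_linear c nf (nilpotent0 i)) => x.
by rewrite addr0.
Qed.

Lemma nilpotent_sum i (T : Type) (s : seq T) (P : pred T) (F : T -> signal K n) :
  (forall u, nilpotent i (F u)) -> nilpotent i (fun x => \sum_(u <- s | P u) F u x).
Proof.
move=> nF; elim: s => [|u s IHs].
  by apply: nilpotent_ext (nilpotent0 i) => x; rewrite big_nil.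
case Pu: (P u); last by apply: nilpotent_ext IHs => x; rewrite big_cons Pu.
apply: nilpotent_ext (nilpotent_linear 1 (nF u) IHs) => x.
by rewrite big_cons Pu mul1r.
Qed.

Lemma nilpotent_delta i (b : mi n) f : nilpotent i f -> nilpotent i (deltaPow b f).
Proof.
case=> N fN; exists N; rewrite /deltaPow -/(delta_on _ _ _) iter_delta_on fN.
exact: linear_op0 (delta_linear b).
Qed.

Lemma nilpotent_diffop i j f : nilpotent i f -> nilpotent i (diffop j f).
Proof. by move=> /(nilpotent_delta (mi1 j 1)); rewrite deltaPow1. Qed.

(** Iterated form of Delta t = t Delta + Delta + 1. It shows that multiplication by t_i raises the
    nilpotency order by at most one. *)
Lemma iter_diffop_tM i N f x :
  iter N.+1 (diffop i) (fun x => (x i)%:R * f x) x =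
  (x i)%:R * iter N.+1 (diffop i) f x +
  N.+1%:R * (iter N.+1 (diffop i) f x + iter N (diffop i) f x).
Proof.
elim: N x => [|N IHN] x.
  by rewrite /= /diffop ffunE eqxx addn1 -natr1; ring.
rewrite iterS {1}/diffop !IHN ffunE eqxx addn1 -natr1 !iterS /diffop -!natr1; ring.
Qed.

Lemma nilpotent_tM i j f : nilpotent i f -> nilpotent i (fun x => (x j)%:R * f x).
Proof.
case=> N fN; exists N.+1; case: (eqVneq i j) => [ij|nij].
  rewrite -ij; apply: functional_extensionality => x.
  by rewrite iter_diffop_tM (iter_diffop_0 fN (leqnSn N)) fN addr0 !mulr0 addr0.
rewrite (@iter_diffopM i _ (fun x => (x j)%:R)) => [|x].
  rewrite (iter_diffop_0 fN (leqnSn N)).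
  by apply: functional_extensionality => x; rewrite mulr0.
by rewrite ffunE eq_sym (negbTE nij) addn0.
Qed.

Lemma nilpotent_mono i (a : mi n) f : nilpotent i f -> nilpotent i (fun x => mono K a x * f x).
Proof.
rewrite /mono => nf; elim: (index_enum _) => [|j s IHs].
  by apply: nilpotent_ext nf => x; rewrite big_nil mul1r.
apply: (@nilpotent_ext i
  (fun x => (x j)%:R ^+ a j * ((\prod_(k <- s) (x k)%:R ^+ a k) * f x))) => [x|].
  by rewrite big_cons mulrA.
elim: (a j) => [|k IHk].
  by apply: nilpotent_ext IHs => x; rewrite mul1r.
by apply: nilpotent_ext (nilpotent_tM j IHk) => x; rewrite exprS mulrA.
Qed.

Lemma nilpotent_peval i (q : mpoly K n) : nilpotent i (peval q).
Proof.
apply: nilpotent_sum => u; apply: nilpotentZ.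
have n1 : nilpotent i (fun=> 1).
  by exists 1%N; apply: functional_extensionality => x; exact: subrr.
by apply: nilpotent_ext (nilpotent_mono u.2 n1) => x; rewrite mulr1.
Qed.

Lemma nilpotent_act i (s : Sn K n) f : nilpotent i f -> nilpotent i (act s f).
Proof.
move=> nf; apply: nilpotent_sum => u.
apply: nilpotent_ext (nilpotentZ u.1.1 (nilpotent_mono u.1.2 (nilpotent_delta u.2 nf))).
by move=> x; rewrite /act_term mulrA.
Qed.

(** * Independence of exponentials with distinct exponent vectors *)

(** A nonzero scalar plus a nilpotent operator is injective: f = -(d/c) Delta f, so each known
    vanishing power Delta^(N+1) f = 0 yields Delta^N f = 0. *)
Lemma scale_diffop_nilpotent_inj i (c d : K) f : c != 0 -> nilpotent i f ->
  (fun x => c * f x + d * diffop i f x) = (fun=> 0) -> f = fun=> 0.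
Proof.
move=> c0 [N fN] E.
have {}E : f = fun x => (- d / c) * diffop i f x.
  apply: functional_extensionality => x; have /eqP := congr1 (fun g => g x) E.
  rewrite addr_eq0 => /eqP cf; apply: (mulfI c0).
  by rewrite cf; field.
elim: N fN => [//|N IHN] fN; apply: IHN; rewrite {1}E.
rewrite (linear_opZ _ _ (linear_op_iter _ (@diffop_linear i))) -iterSr fN.
by apply: functional_extensionality => x; rewrite mulr0.
Qed.

(* sigma_j - c maps F exp_mu to ((mu_j - c) F + mu_j Delta_j F) exp_mu. *)
Definition twist (mu : 'I_n -> K) j (c : K) f : signal K n :=
  fun x => (mu j - c) * f x + mu j * diffop j f x.

Lemma twistE mu j c f x :
  twist mu j c f x * expo mu x =
  f (shift j x) * expo mu (shift j x) - c * (f x * expo mu x).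
Proof. by rewrite /twist expo_shift /diffop; ring. Qed.

Lemma nilpotent_twist i mu j c f : nilpotent i f -> nilpotent i (twist mu j c f).
Proof.
by move=> nf; apply: nilpotent_linear => //; apply: nilpotentZ; exact: nilpotent_diffop.
Qed.

(** Outer induction on the list of other exponentials, inner induction on the nilpotency order of
    the first one's coefficient. Twisting with c = [mu t j] lowers that order and is injective on
    [F0]. *)
Lemma exp_poly_indep1 (T : eqType) (s : seq T) (F0 : signal K n) (mu0 : 'I_n -> K)
    (F : T -> signal K n) (mu : T -> 'I_n -> K) :
  (forall i, mu0 i != 0) -> (forall i, nilpotent i F0) ->
  (forall t i, nilpotent i (F t)) ->
  (forall t, t \in s -> exists j, mu t j != mu0 j) ->
  (forall x, F0 x * expo mu0 x + \sum_(t <- s) F t x * expo (mu t) x = 0) ->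
  F0 = fun=> 0.
Proof.
move=> mu00; elim: s F0 F => [|t s IHs] F0 F nF0 nF nmu E.
  apply: functional_extensionality => x; have /eqP := E x.
  by rewrite big_nil addr0 mulf_eq0 (negbTE (expo_neq0 _ _)) // orbF => /eqP.
have [j nj] := nmu t (mem_head _ _); have [N FN] := nF t j.
elim: N F0 F nF0 nF E FN => [|N IHN] F0 F nF0 nF E FN.
  (* Order zero means [F t] = 0, so the term of [t] drops out. *)
  apply: (IHs F0 F) => // [u us|x]; first by apply: nmu; rewrite inE us orbT.
  by have := E x; rewrite big_cons /= in FN *; rewrite FN mul0r add0r.
have c0 : mu0 j - mu t j != 0 by rewrite subr_eq0 eq_sym.
(* By injectivity it suffices that the twisted [F0] vanishes. *)
apply: (scale_diffop_nilpotent_inj (i := j) (d := mu0 j) c0) => //.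
apply: (IHN _ (fun u => twist (mu u) j (mu t j) (F u))).
- by move=> i; exact: nilpotent_twist.
- by move=> u i; exact: nilpotent_twist.
(* The twisted relation is the original one at the shifted point minus [mu t j] times the one at
   [x]. *)
- move=> x; rewrite -/(twist mu0 j (mu t j) F0 x) twistE.
  have : \sum_(u <- t :: s) twist (mu u) j (mu t j) (F u) x * expo (mu u) x =
    \sum_(u <- t :: s) F u (shift j x) * expo (mu u) (shift j x) -
    mu t j * \sum_(u <- t :: s) F u x * expo (mu u) x.
    by rewrite mulr_sumr -sumrB; apply: eq_bigr => u _; rewrite twistE.
  move=> ->; have := E (shift j x); have := E x.
  move: (\sum_(u <- _) _) => A; move: (\sum_(u <- _) _) => B EA EB.
  have -> : A = - (F0 x * expo mu0 x) by apply/eqP; rewrite -addr_eq0 addrC EA.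
  have -> : B = - (F0 (shift j x) * expo mu0 (shift j x)).
    by apply/eqP; rewrite -addr_eq0 addrC EB.
  by ring.
(* For [t] itself the scalar part cancels and a multiple of Delta_j remains, so order N+1 becomes
   N. *)
- have -> : twist (mu t) j (mu t j) (F t) = fun x => mu t j * diffop j (F t) x.
    by apply: functional_extensionality => x; rewrite /twist subrr mul0r add0r.
  rewrite (linear_opZ _ _ (linear_op_iter _ (@diffop_linear j))) -iterSr FN.
  by apply: functional_extensionality => x; rewrite mulr0.
Qed.

Lemma exp_poly_indep l (F : 'I_l -> signal K n) (mu : 'I_l -> 'I_n -> K) :
  (forall t i, mu t i != 0) -> (forall t i, nilpotent i (F t)) -> injective mu ->
  (forall x, \sum_t F t x * expo (mu t) x = 0) -> forall t x, F t x = 0.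
Proof.
move=> mu0 nF mu_inj E t x.
suff -> : F t = fun=> 0 by [].
apply: (@exp_poly_indep1 _ [seq u <- enum 'I_l | u != t] _ (mu t) F mu) => // [u|y].
  rewrite mem_filter => /andP[nut _].
  case: (pickP (fun j => mu u j != mu t j)) => [j nj|all]; first by exists j.
  case/eqP: nut; apply: mu_inj; apply: functional_extensionality => j.
  by apply/eqP; move/negbFE: (all j).
by rewrite big_filter big_enum_cond -[RHS](E y) [in RHS](bigD1 t).
Qed.

End DifferenceOperators.

(** * Blocks of indices with equal exponent vector *)

Section Classes.
Variables (K : fieldType) (n m l : nat) (cls : 'I_m -> 'I_l).

Lemma mem_Kcls i k : (k \in Kcls cls i) = (cls k == i).
Proof. by rewrite mem_filter mem_enum andbT. Qed.

Lemma uniq_Kcls i : uniq (Kcls cls i).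
Proof. by rewrite filter_uniq ?enum_uniq. Qed.

Lemma phiE (Ki : seq 'I_m) (c : seq (Sn K n)) k : uniq Ki -> size c = size Ki ->
  phi Ki c k = if k \in Ki then nth [::] c (index k Ki) else [::].
Proof.
rewrite /phi; elim: Ki c => [|k0 Ki IHK] [|c0 c] //= /andP[nk0 uK] [sc].
have := IHK c uK sc; rewrite inE [k == k0]eq_sym; case: eqP => [<-|_] //=.
by rewrite (negbTE nk0) => ->; rewrite cats0.
Qed.

(** The classes are disjoint, so only the block of the class of [k] reaches coordinate [k]. *)
Lemma dsumE (b : 'I_l -> seq (Sn K n)) k :
  (forall i, size (b i) = size (Kcls cls i)) ->
  dsum cls b k = phi (Kcls cls (cls k)) (b (cls k)) k.
Proof.
move=> sb.
have phi_out i : cls k != i -> phi (Kcls cls i) (b i) k = [::].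
  by move=> /negbTE nki; rewrite phiE ?uniq_Kcls // mem_Kcls nki.
have flatten_out (s : seq 'I_l) : cls k \notin s ->
    flatten [seq phi (Kcls cls i) (b i) k | i <- s] = [::].
  elim: s => //= i s IHs; rewrite inE negb_or => /andP[ni ns].
  by rewrite phi_out // IHs.
rewrite /dsum; have := enum_uniq 'I_l; have: cls k \in enum 'I_l by rewrite mem_enum.
elim: (enum 'I_l) => //= i s IHs; rewrite inE; case: eqVneq => [<- _|nki /= ks] /andP[nis us].
  by rewrite flatten_out // cats0.
by rewrite phi_out // IHs.
Qed.

Lemma sum_nth_index (T : eqType) (s : seq T) (f : T -> signal K n) (c : seq (Sn K n)) x :
  uniq s ->
  \sum_(j < size (map f s)) act (nth [::] c j) (nth (fun=> 0) (map f s) j) x =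
  \sum_(k <- s) act (nth [::] c (index k s)) (f k) x.
Proof.
case: s => [|k0 s] us; first by rewrite big_ord0 big_nil.
rewrite (big_nth k0) big_mkord size_map; apply: eq_bigr => j _.
by rewrite index_uniq // (nth_map k0).
Qed.

Variable p : 'I_m -> mpoly K n.

(** Replaces positions in K_i by the indices themselves, so that blocks fit a partition of the full
    sum. *)
Lemma kerSeq_hc i (c : seq (Sn K n)) : kerSeq (hc p cls i) c <->
  size c = size (Kcls cls i) /\
  forall x, \sum_(k | cls k == i) act (nth [::] c (index k (Kcls cls i))) (peval (p k)) x = 0.
Proof.
have sz : size (hc p cls i) = size (Kcls cls i) by rewrite size_map.
have E x : \sum_(j < size (hc p cls i))
    act (nth [::] c j) (nth (fun=> 0) (hc p cls i) j) x =
    \sum_(k | cls k == i) act (nth [::] c (index k (Kcls cls i))) (peval (p k)) x.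
  rewrite /hc sum_nth_index ?uniq_Kcls //.
  by rewrite {1}/Kcls big_filter big_enum_cond.
by split=> -[sc c0]; split=> [|x]; rewrite ?sc //; [rewrite -E | rewrite E].
Qed.

Variable lam : 'I_m -> 'I_n -> K.

Lemma size_inH (b : 'I_l -> seq (Sn K n)) :
  (forall i, inH (muc lam cls i) (hc p cls i) (b i)) ->
  forall i, size (b i) = size (Kcls cls i).
Proof. by move=> bH i; have [c [/kerSeq_hc[sc _] [-> _]]] := bH i. Qed.

Hypothesis hcls : forall j k, cls j = cls k <-> lam j = lam k.

(** The class of [k] contains [k], so the default of [head] is never taken. *)
Lemma muc_cls k : muc lam cls (cls k) = lam k.
Proof.
have : k \in Kcls cls (cls k) by rewrite mem_Kcls.
have : {subset Kcls cls (cls k) <= [pred j | cls j == cls k]}.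
  by move=> j; rewrite mem_Kcls.
rewrite /muc; case: (Kcls _ _) => //= j s sub _.
by apply/hcls/eqP; apply: sub; exact: mem_head.
Qed.

Hypothesis lam0 : forall j i, lam j i != 0.

Lemma sum_act_psig (a c : 'I_m -> Sn K n) x :
  (forall k, Sequiv (a k) (chiS (lam k) (c k))) ->
  \sum_k act (a k) (psig p lam k) x =
  \sum_i (\sum_(k | cls k == i) act (c k) (peval (p k)) x) * expo (muc lam cls i) x.
Proof.
move=> ac; rewrite (partition_big cls xpredT) //=; apply: eq_bigr => i _.
rewrite mulr_suml; apply: eq_bigr => k /eqP <-.
by rewrite (act_Sequiv _ (ac k)) muc_cls -act_chiS.
Qed.

Hypothesis hsurj : forall i, exists j, cls j = i.

(** Every class is inhabited, so each mu^i is some [lam j]: nonzero, and distinct for distinct i.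
    Independence then separates the blocks. *)
Lemma kerS_psig (a c : 'I_m -> Sn K n) :
  (forall k, Sequiv (a k) (chiS (lam k) (c k))) ->
  kerS (psig p lam) a <->
  forall i x, \sum_(k | cls k == i) act (c k) (peval (p k)) x = 0.
Proof.
move=> ac; split=> [ka|c0 x]; last first.
  by rewrite (sum_act_psig _ ac) big1 // => i _; rewrite c0 mul0r.
apply: (@exp_poly_indep _ _ _ _ (muc lam cls)) => [t i|t i|t u|x].
- by have [j <-] := hsurj t; rewrite muc_cls.
- by apply: nilpotent_sum => k; apply: nilpotent_act; exact: nilpotent_peval.
- by have [j <-] := hsurj t; have [k <-] := hsurj u; rewrite !muc_cls => /hcls.
- by rewrite -(sum_act_psig _ ac) ka.
Qed.

End Classes.

(** * The kernel as a direct sum, and minimality of its solution set *)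

Theorem theorem6p4 (K : fieldType) (Kinf : forall s : seq K, exists x, x \notin s)
  (n m l : nat) (p : 'I_m -> mpoly K n) (lam : 'I_m -> 'I_n -> K)
  (lam0 : forall j i, lam j i != 0)
  (cls : 'I_m -> 'I_l)
  (hcls : forall j k, cls j = cls k <-> lam j = lam k)
  (hsurj : forall i, exists j, cls j = i) :
  (* kernel = sum_i phi_i(H_i) *)
  (forall a : 'I_m -> Sn K n,
     kerS (psig p lam) a <->
     exists b : 'I_l -> seq (Sn K n),
       (forall i, inH (muc lam cls i) (hc p cls i) (b i)) /\ rowEq a (dsum cls b)) /\
  (* the sum is direct *)
  (forall b : 'I_l -> seq (Sn K n),
     (forall i, inH (muc lam cls i) (hc p cls i) (b i)) ->
     rowEq (dsum cls b) (@zrow K n m) ->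
     forall i, rowEq (phi (Kcls cls i) (b i)) (@zrow K n m)) /\
  (* a matrix whose rows generate the kernel is a kernel representation of the VMPUM of {p} *)
  (forall (q : nat) (R : 'I_q -> 'I_m -> Sn K n),
     (forall r, kerS (psig p lam) (R r)) ->
     (forall a, kerS (psig p lam) a -> exists c : 'I_q -> Sn K n, rowEq a (lincomb c R)) ->
     sol R (psig p lam) /\
     (forall (q' : nat) (R' : 'I_q' -> 'I_m -> Sn K n),
        sol R' (psig p lam) -> forall g, sol R g -> sol R' g)).

Proof.
have uK := uniq_Kcls cls; have Ksize := @size_inH K n m l cls p lam.
have idx k : (index k (Kcls cls (cls k)) < size (Kcls cls (cls k)))%N.
  by rewrite index_mem mem_Kcls.
have kin k : k \in Kcls cls (cls k) by rewrite mem_Kcls.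
split; [|split].
- move=> a; split=> [ka|[b [bH ab]]].
    (* Undoing chi entrywise; the blocks of [c] then lie in the kernels of the h_i, and the blocks
       of [a] in the H_i. *)
    pose c k := chiS (fun i => (lam k i)^-1) (a k).
    have ac k : Sequiv (a k) (chiS (lam k) (c k)).
      by move=> u v; rewrite chiS_inv.
    have c0 := (kerS_psig p hcls lam0 hsurj ac).1 ka.
    exists (fun i => [seq a k | k <- Kcls cls i]); split=> [i|k].
      exists [seq c k | k <- Kcls cls i]; split; last split; rewrite ?size_map //.
        apply/kerSeq_hc; split=> [|x]; first by rewrite size_map.
        rewrite -[RHS](c0 i x); apply: eq_bigr => k /eqP ki.
        by rewrite (nth_map k) ?nth_index // -ki.
      move=> j ltj u v; have [k0 _] := hsurj i.
      rewrite !(nth_map k0) // ac; congr (coef (chiS _ _) _ _).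
      have : nth k0 (Kcls cls i) j \in Kcls cls i by exact: mem_nth.
      by rewrite mem_Kcls -[lam _](muc_cls hcls) => /eqP ->.
    rewrite dsumE => [|i]; last by rewrite size_map.
    by rewrite phiE ?size_map // kin (nth_map k) ?nth_index.
  have sb := Ksize b bH.
  (* Finite choice of preimages under chi, one for each block. *)
  have [c cP] := @fin_all_exists 'I_l (fun=> seq (Sn K n))
    (fun i d => kerSeq (hc p cls i) d /\ size (b i) = size d /\
      forall j, (j < size d)%N ->
        Sequiv (chiS (muc lam cls i) (nth [::] d j)) (nth [::] (b i) j)) bH.
  apply/(@kerS_psig _ _ _ _ _ p _ hcls lam0 hsurj _
    (fun k => nth [::] (c (cls k)) (index k (Kcls cls (cls k))))) => [k u v|i x].
    have [/kerSeq_hc[sc _] [_ cb]] := cP (cls k).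
    by rewrite ab dsumE // phiE // kin -(muc_cls hcls) cb // sc.
  have [/kerSeq_hc[_ c0] _] := cP i; rewrite -[RHS](c0 x).
  by apply: eq_bigr => k /eqP <-.
(* At coordinate [k] the block of its own class equals the whole sum, and every other block is
   zero. *)
- move=> b bH b0 i k; have sb := Ksize b bH.
  case: (eqVneq (cls k) i) => [<- u v|/negbTE nki u v]; first by rewrite -dsumE // b0.
  by rewrite phiE // mem_Kcls nki.
(* A solution set containing p has all its rows in the kernel, hence they are combinations of the
   rows of [R] and annihilate whatever [R] annihilates. *)
- move=> q R RH Rgen; split=> // q' R' R'H g Rg r x.
  have [c cE] := Rgen _ (R'H r).
  transitivity (\sum_(j < m) \sum_(s < q) act (c s) (act (R s j) (g j)) x).
    apply: eq_bigr => j _; rewrite (act_Sequiv _ (cE j)) act_flatten big_map big_enum.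
    by apply: eq_bigr => s _; rewrite act_mulS.
  (* Linearity of the action of [c s] collects the sum over j into row [s] of [R] applied to [g],
     which is zero. *)
  rewrite exchange_big big1 // => s _ /=; 
  have <- := congr1 (fun h => h x)
    (linear_op_sum (index_enum _) (fun j => act (R s j) (g j)) (act_linear (c s))).
  have -> : (fun x => \sum_j act (R s j) (g j) x) = fun=> 0.
    by apply: functional_extensionality => y; exact: Rg.
  by rewrite (linear_op0 (act_linear (c s))).
Qed.
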